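(* Let $m,n,\ell$ be positive integers, let $L:(\mathbb{R}^{n\times n})^m\to\mathbb{R}^\ell$ be linear, let $(A_1,\dots,A_m)\in(\mathbb{R}^{n\times n})^m$, and let $G=\mathcal{O}_n$ or $G=\mathrm{SO}_n$. If either (i) $\ell=2$ and $n\ge 3$, or (ii) $\ell\ge 3$ and $n\ge 2^{\ell-1}$, then each of the sets $L(\boldsymbol{O}_i(A_1,\dots,A_m;G))$, $i=1,2,3$, is star-shaped with respect to the origin.
   Context: $\mathcal{O}_n=\{U\in\mathbb{R}^{n\times n}:U^tU=UU^t=I_n\}$ and $\mathrm{SO}_n=\{U\in\mathcal{O}_n:\det U>0\}$. $(\mathbb{R}^{n\times n})^m$ is the space of $m$-tuples of real $n\times n$ matrices. For $A_1,\dots,A_m\in\mathbb{R}^{n\times n}$ and $G=\mathcal{O}_n$ or $\mathrm{SO}_n$, define $\boldsymbol{O}_1(A_1,\dots,A_m;G)=\{(A_1V,\dots,A_mV):V\in G\}$, $\boldsymbol{O}_2(A_1,\dots,A_m;G)=\{(UA_1,\dots,UA_m):U\in G\}$, $\boldsymbol{O}_3(A_1,\dots,A_m;G)=\{(UA_1V,\dots,UA_mV):U,V\in G\}$. A set $S$ in a real vector space is star-shaped with respect to $c\in S$ if $\alpha x+(1-\alpha)c\in S$ for all $0\le\alpha\le 1$ and all $x\in S$ (in particular $c\in S$). *)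

(* Defs.v *)
From HB Require Import structures.
From mathcomp Require Import all_boot all_order all_algebra.
From mathcomp Require Import all_classical all_reals.

Set Implicit Arguments.
Unset Strict Implicit.
Unset Printing Implicit Defensive.

Import Order.TTheory GRing.Theory Num.Theory.
Local Open Scope classical_set_scope.
Local Open Scope ring_scope.

Definition orthogonal_group (R : realType) (n : nat) : set 'M[R]_n :=
  [set U | U^T *m U = 1%:M /\ U *m U^T = 1%:M].

Definition special_orthogonal_group (R : realType) (n : nat) : set 'M[R]_n :=
  [set U | orthogonal_group U /\ 0 < \det U].

(* An m-tuple of n x n matrices is a finite function on 'I_m, so that the
   space of tuples carries the pointwise vector space structure. *)
Definition orbit1 (R : realType) (m n : nat) (A : {ffun 'I_m -> 'M[R]_n})
    (G : set 'M[R]_n) : set {ffun 'I_m -> 'M[R]_n} :=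
  [set [ffun i => A i *m V] | V in G].

Definition orbit2 (R : realType) (m n : nat) (A : {ffun 'I_m -> 'M[R]_n})
    (G : set 'M[R]_n) : set {ffun 'I_m -> 'M[R]_n} :=
  [set [ffun i => U *m A i] | U in G].

Definition orbit3 (R : realType) (m n : nat) (A : {ffun 'I_m -> 'M[R]_n})
    (G : set 'M[R]_n) : set {ffun 'I_m -> 'M[R]_n} :=
  [set [ffun i => U *m A i *m V] | U in G & V in G].

Definition star_shaped (R : realType) (E : lmodType R) (S : set E) (c : E) :
    Prop :=
  S c /\ forall (a : R) (x : E), 0 <= a <= 1 -> S x ->
    S (a *: x + (1 - a) *: c).

(* Main.v *)
Require Import Defs.
From HB Require Import structures.
From mathcomp Require Import all_boot all_order all_algebra.
From mathcomp Require Import all_classical all_reals.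
From mathcomp Require Import all_analysis ring lra.

Set Implicit Arguments.
Unset Strict Implicit.
Unset Printing Implicit Defensive.

Import Order.TTheory GRing.Theory Num.Theory.
Import numFieldNormedType.Exports.
Local Open Scope classical_set_scope.
Local Open Scope ring_scope.

(** Each of the three orbits is a union of sets F(SO_n) with F linear on n x n
matrices and F(I) a prescribed point of the orbit: freeze the outer factors and
let one extra factor X run through SO_n, as in X |-> (X U A_i V)_i. Everything
therefore reduces to one claim: for a linear Phi from n x n matrices to R^l and
0 <= a <= 1, some V in SO_n satisfies Phi(V) = a Phi(I)
([special_orthogonal_shrink]).

Suppose first that n >= N for some N such that R^N carries a Clifford system of
l anticommuting skew complex structures E_1, ..., E_l; there is one for
N = 2^(l-1), l >= 3, and N = 4 serves l = 2. If the size is exactly N and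
Phi(I) is not 0, a dimension count gives a unit vector c for which
J = sum c_i E_i satisfies Phi(J) = mu Phi(I) ([complex_structure_on_ray]). The
rotations cos t I + sin t J then move Phi along the line through Phi(I), and
replacing J by -J if needed one may shrink Phi(I) by any factor.

If N does not divide n, no such circle of rotations fills the whole space. It
can still be used on a coordinate block of size N: with P the orthogonal
projection onto the block, it moves a point Phi(V) to exactly
Phi(V) - e Phi(P V), while V itself moves by at most sqrt(2e)
([shrink_block]). The n cyclic windows of length N cover every coordinate
equally often, so their projections add up to N I. Treating them one after the
other moves Phi(V) to (1 - N e) Phi(V), up to an error of order e sqrt(e): each
window acts on a matrix that is still within O(sqrt e) of the initial one
([shrink_round]). This is an Euler scheme for the equation x' = -x inside
Phi(SO_n), with a total error that tends to 0 with the step; as Phi(SO_n) is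
compact, it contains the whole segment from Phi(I) to 0
([euler_star_shaped]).

Only n = 3, l = 2 remains. There, local moves may fail, but SO_3 is the image of
the unit sphere of R^4 under a quadratic map, the rotation attached to a
quaternion. By Brickman's theorem two quadratic forms on R^n, n >= 3, map the
unit sphere onto a convex set ([qforms_convex]), so Phi(SO_3) is convex. It
contains -Phi(I)/3, since the half turns about the three axes add up to -I.
*)

(** * Preliminaries *)

(** These open the linear operations in an entry while leaving matrix products
closed, where [mxE] would expand them into sums. *)
Lemma mx_entryD (R : nmodType) m n (A B : 'M[R]_(m, n)) i j :
  (A + B) i j = A i j + B i j.
Proof. by rewrite mxE. Qed.

Lemma mx_entryN (R : zmodType) m n (A : 'M[R]_(m, n)) i j :
  (- A) i j = - A i j.
Proof. by rewrite mxE. Qed.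

Lemma mx_entryZ (R : pzRingType) m n c (A : 'M[R]_(m, n)) i j :
  (c *: A) i j = c * A i j.
Proof. by rewrite mxE. Qed.

Definition mx_entry_lin := (mx_entryD, mx_entryN, mx_entryZ).

Lemma row_sqr_norm_gt0 (R : realDomainType) n (c : 'rV[R]_n) :
  c != 0 -> 0 < (c *m c^T) 0 0.
Proof.
move=> c0; rewrite mxE; under eq_bigr do rewrite mxE -expr2.
rewrite lt0r sumr_ge0 ?andbT => [|i _]; last exact: sqr_ge0.
apply: contraNneq c0 => /eqP.
rewrite psumr_eq0 => [/allP z0|i _]; last exact: sqr_ge0.
apply/eqP/rowP=> i; rewrite mxE; apply/eqP; rewrite -sqrf_eq0.
exact: (z0 i (mem_index_enum i)).
Qed.

(** The Gram matrix carries the squared norms of the rows on its diagonal; it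
turns identities between matrices into bounds on entries. *)
Lemma sqr_entry_le_gram (R : realDomainType) m n (A : 'M[R]_(m, n)) i j :
  A i j ^+ 2 <= (A *m A^T) i i.
Proof.
rewrite mxE (bigD1 j) //= mxE -expr2 lerDl sumr_ge0 // => k _.
by rewrite mxE -expr2 sqr_ge0.
Qed.

(** * Brickman's theorem on two quadratic forms *)

Definition qform (R : comRingType) n (M : 'M[R]_n) (x : 'rV[R]_n) : R :=
  (x *m M *m x^T) 0 0.

(** Twice the symmetric bilinear form attached to [qform M]. *)
Definition polar_form (R : comRingType) n (M : 'M[R]_n) (x y : 'rV[R]_n) : R :=
  (x *m M *m y^T) 0 0 + (y *m M *m x^T) 0 0.

Lemma qform_comb3 (R : comRingType) n (M : 'M[R]_n) (x y z : 'rV[R]_n) a b c :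
  qform M (a *: x + b *: y + c *: z) =
    a ^+ 2 * qform M x + b ^+ 2 * qform M y + c ^+ 2 * qform M z
    + a * b * polar_form M x y + a * c * polar_form M x z
    + b * c * polar_form M y z.
Proof.
rewrite /qform /polar_form [(_ + _ + _)^T]linearD /= [(_ + _)^T]linearD /=.
rewrite [(a *: _)^T]linearZ [(b *: _)^T]linearZ [(c *: _)^T]linearZ /=.
rewrite !(mulmxDl, mulmxDr).
rewrite -!(scalemxAl, scalemxAr) !mx_entry_lin; ring.
Qed.

Lemma qform_comb2 (R : comRingType) n (M : 'M[R]_n) (x y : 'rV[R]_n) a b :
  qform M (a *: x + b *: y) =
    a ^+ 2 * qform M x + b ^+ 2 * qform M y + a * b * polar_form M x y.
Proof.
have := qform_comb3 M x y 0 a b 0; rewrite scale0r addr0 => ->.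
by rewrite expr0n /= !mulr0 !mul0r !addr0.
Qed.

Lemma qformZ (R : comRingType) n (M : 'M[R]_n) (x : 'rV[R]_n) a :
  qform M (a *: x) = a ^+ 2 * qform M x.
Proof.
have := qform_comb2 M x 0 a 0.
by rewrite scale0r addr0 expr0n /= !mulr0 !mul0r !addr0.
Qed.

Lemma polar_formNr (R : comRingType) n (M : 'M[R]_n) (x y : 'rV[R]_n) :
  polar_form M x (- y) = - polar_form M x y.
Proof.
rewrite /polar_form [(- y)^T]linearN /= mulmxN !mulNmx !mx_entry_lin.
by rewrite opprD.
Qed.

Lemma polar_form_comb3 (R : comRingType) n (M : 'M[R]_n)
    (w x y z : 'rV[R]_n) a b c :
  polar_form M w (a *: x + b *: y + c *: z) =
    a * polar_form M w x + b * polar_form M w y + c * polar_form M w z.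
Proof.
rewrite /polar_form [(_ + _ + _)^T]linearD /= [(_ + _)^T]linearD /=.
rewrite [(a *: _)^T]linearZ [(b *: _)^T]linearZ [(c *: _)^T]linearZ /=.
rewrite !(mulmxDl, mulmxDr).
rewrite -!(scalemxAl, scalemxAr) !mx_entry_lin; ring.
Qed.

Lemma polar_formxx (R : comRingType) n (M : 'M[R]_n) (x : 'rV[R]_n) :
  polar_form M x x = qform M x *+ 2.
Proof. by []. Qed.

Lemma qform_lin (R : comRingType) n (M N : 'M[R]_n) a b (x : 'rV[R]_n) :
  qform (a *: M + b *: N) x = a * qform M x + b * qform N x.
Proof.
by rewrite /qform mulmxDr mulmxDl -!scalemxAr -!scalemxAl !mx_entry_lin.
Qed.

(** Two linear equations in at least three unknowns. *)
Lemma polar_orthogonal (R : fieldType) n (M : 'M[R]_n) (x y : 'rV[R]_n) :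
  (3 <= n)%N ->
  exists2 z, z != 0 & polar_form M x z = 0 /\ polar_form M y z = 0.
Proof.
move=> n3; pose S := M + M^T.
have polE u v : polar_form M u v = (v *m (S *m u^T)) 0 0.
  rewrite /polar_form /S mulmxDl mulmxDr mx_entryD mulmxA addrC; congr (_ + _).
  have -> : v *m (M^T *m u^T) = (u *m M *m v^T)^T by rewrite !trmx_mul !trmxK.
  by rewrite [RHS]mxE.
pose B := row_mx (S *m x^T) (S *m y^T).
have : kermx B != 0.
  by rewrite kermx_eq0 -row_leq_rank -ltnNge (leq_ltn_trans (rank_leq_col B)).
case/rowV0Pn=> z /sub_kermxP; rewrite mul_mx_row => /eqP.
by rewrite row_mx_eq0 => /andP[/eqP zx /eqP zy] z0; exists z;
  rewrite ?polE ?zx ?zy ?mxE.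
Qed.

(** As [x] and [y] are isotropic and conjugate for [F], the form [F] vanishes on
the whole segment from [x] to [y], and [G] changes sign there. *)
Lemma common_zero_on_line (R : rcfType) n (F G : 'M[R]_n) (x y : 'rV[R]_n) :
  x != 0 -> y != 0 -> qform F x = 0 -> qform F y = 0 ->
  polar_form F x y = 0 -> qform G x <= 0 -> 0 <= qform G y ->
  exists2 z, z != 0 & qform F z = 0 /\ qform G z = 0.
Proof.
move=> x0 y0 Fx Fy Fxy Gx Gy.
pose p : {poly R} := (1 - 'X) ^+ 2 * (qform G x)%:P + 'X ^+ 2 * (qform G y)%:P
   + (1 - 'X) * 'X * (polar_form G x y)%:P.
have pE s : p.[s] = qform G ((1 - s) *: x + s *: y).
  by rewrite qform_comb2 /p !hornerE.
have [|s s01 /rootP] := @poly_ivt R p 0 1 ler01.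
  by rewrite !pE subr0 subrr !scale1r !scale0r addr0 add0r Gx Gy.
rewrite pE => Gs.
have [zs0|zs0] := eqVneq ((1 - s) *: x + s *: y) 0; last first.
  by exists ((1 - s) *: x + s *: y);
    rewrite // Gs qform_comb2 Fx Fy Fxy !mulr0 !addr0.
(* The segment crosses the origin, so y is a multiple of x and G x = 0. *)
exists x => //; split=> //.
have s0 : s != 0.
  apply: contraNneq x0 => s0; move: zs0.
  by rewrite s0 subr0 scale1r scale0r addr0 => ->.
have yE : y = (- (s^-1 * (1 - s))) *: x.
  apply: (scalerI s0); rewrite scalerA mulrN mulrA divff // mul1r scaleNr.
  by apply/eqP; rewrite -addr_eq0 addrC zs0.
apply/eqP; rewrite eq_le Gx /=.
move: Gy; rewrite yE qformZ pmulr_rge0 // exprn_even_gt0 //=.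
by apply: contraNneq y0 => c0; rewrite yE c0 scale0r.
Qed.

(** The cone of zeros of [F] joins [x] to [y] avoiding the origin, and [G]
changes sign along the way. When [x] and [y] are not conjugate, take [z]
conjugate to both. If [z] is isotropic, join [x] to [z] and [z] to [y] by
segments; otherwise bend the segment from [x] to [y] in the direction of [z]
just enough to compensate the cross term. *)
Lemma common_zero (R : rcfType) n (F G : 'M[R]_n) (x y : 'rV[R]_n) :
  (3 <= n)%N -> x != 0 -> y != 0 -> qform F x = 0 -> qform F y = 0 ->
  qform G x <= 0 -> 0 <= qform G y ->
  exists2 z, z != 0 & qform F z = 0 /\ qform G z = 0.
Proof.
move=> n3 x0 y0 Fx Fy Gx Gy.
have [b0|b0] := eqVneq (polar_form F x y) 0.
  exact: (common_zero_on_line x0 y0).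
have [z z0 [xz yz]] := polar_orthogonal F x y n3.
have zx : polar_form F z x = 0 by rewrite /polar_form addrC.
have zy : polar_form F z y = 0 by rewrite /polar_form addrC.
have [Fz|Fz] := eqVneq (qform F z) 0.
  have [Gz|/ltW Gz] := leP 0 (qform G z).
    exact: (common_zero_on_line x0 z0).
  exact: (common_zero_on_line z0 y0).
(* Changing the sign of y changes the sign of the cross term. *)
wlog bz : y y0 Fy Gy b0 yz zy / polar_form F x y * qform F z < 0.
  move=> wl; case: (ltrgtP (polar_form F x y * qform F z) 0) => [|bz|/eqP].
  - exact: wl.
  - apply: (wl (- y)).
    + by rewrite oppr_eq0.
    + by rewrite -scaleN1r qformZ Fy mulr0.
    + by rewrite -scaleN1r qformZ sqrrN expr1n mul1r.
    + by rewrite polar_formNr oppr_eq0.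
    + rewrite /polar_form addrC -/(polar_form F z (- y)).
      by rewrite polar_formNr zy oppr0.
    + by rewrite polar_formNr zy oppr0.
    + by rewrite polar_formNr mulNr oppr_lt0.
  - by rewrite mulf_eq0 (negbTE b0) (negbTE Fz).
pose k := Num.sqrt (- (polar_form F x y / qform F z)).
have k2 : k ^+ 2 * qform F z = - polar_form F x y.
  rewrite sqr_sqrtr ?mulNr ?divfK // oppr_ge0.
  have -> : polar_form F x y / qform F z =
            polar_form F x y * qform F z / qform F z ^+ 2 by field.
  by rewrite pmulr_lle0 ?ltW // invr_gt0 exprn_even_gt0.
(* On w, the cross term (1 - s)^2 s^2 b is cancelled by the square of the
   coefficient of z, which is why k^2 F z = - b. *)
pose w s := (1 - s) ^+ 2 *: x + s ^+ 2 *: y + (s * (1 - s) * k) *: z.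
have Fw s : qform F (w s) = 0.
  rewrite qform_comb3 Fx Fy xz yz !mulr0 !addr0 !add0r.
  have -> : (s * (1 - s) * k) ^+ 2 * qform F z =
            (s * (1 - s)) ^+ 2 * (k ^+ 2 * qform F z) by ring.
  by rewrite k2; ring.
have w0 s : w s != 0.
  apply/eqP=> ws.
  have polar0 u : polar_form F u (w s) = 0.
    by rewrite ws /polar_form linear0 mulmx0 !mul0mx !mxE addr0.
  move: (polar0 x) (polar0 y); rewrite !polar_form_comb3 xz yz.
  rewrite !polar_formxx Fx Fy !mul0rn !mulr0 !addr0 !add0r.
  have -> : polar_form F y x = polar_form F x y by rewrite /polar_form addrC.
  move=> /eqP; rewrite mulf_eq0 (negbTE b0) orbF sqrf_eq0 => /eqP ->.
  by rewrite subr0 expr1n mul1r => /eqP; rewrite (negbTE b0).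
pose p : {poly R} := (1 - 'X) ^+ 4 * (qform G x)%:P + 'X ^+ 4 * (qform G y)%:P
  + ('X * (1 - 'X) * k%:P) ^+ 2 * (qform G z)%:P
  + ((1 - 'X) * 'X) ^+ 2 * (polar_form G x y)%:P
  + ((1 - 'X) ^+ 3 * 'X * k%:P) * (polar_form G x z)%:P
  + ('X ^+ 3 * (1 - 'X) * k%:P) * (polar_form G y z)%:P.
have pE s : p.[s] = qform G (w s).
  by rewrite /p !hornerE qform_comb3; ring.
have [|s s01 /rootP] := @poly_ivt R p 0 1 ler01.
  rewrite !pE /w subr0 subrr !(expr1n, expr0n) /= !(mulr0, mul0r).
  by rewrite !scale1r !scale0r !addr0 add0r Gx Gy.
by rewrite pE => Gs; exists (w s).
Qed.

(** Brickman's theorem. In the plane of values, let p be the wanted point of the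
segment and d its direction. Rotating the coordinates so that d becomes an axis,
and subtracting p times the squared norm, makes p the origin: the first form
vanishes at both ends, the second has opposite signs there, and a common zero of
the two, once normalised, is the wanted vector. *)
Lemma qforms_convex (R : rcfType) n (A B : 'M[R]_n) (x y : 'rV[R]_n) t :
  (3 <= n)%N -> 0 <= t <= 1 -> qform 1%:M x = 1 -> qform 1%:M y = 1 ->
  exists z, [/\ qform 1%:M z = 1,
    qform A z = (1 - t) * qform A x + t * qform A y &
    qform B z = (1 - t) * qform B x + t * qform B y].
Proof.
move=> n3 /andP[t0 t1] x1 y1.
pose dA := qform A y - qform A x; pose dB := qform B y - qform B x.
pose pA := (1 - t) * qform A x + t * qform A y.
pose pB := (1 - t) * qform B x + t * qform B y.
have [dd0|dd0] := eqVneq (dA ^+ 2 + dB ^+ 2) 0.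
  move: dd0 => /eqP; rewrite paddr_eq0 ?sqr_ge0 // !sqrf_eq0 !subr_eq0.
  by case/andP=> /eqP eA /eqP eB; exists x; split => //; rewrite ?eA ?eB; ring.
have dd : 0 < dA ^+ 2 + dB ^+ 2 by rewrite lt0r dd0 addr_ge0 ?sqr_ge0.
have neq0 (u : 'rV[R]_n) : qform 1%:M u = 1 -> u != 0.
  move=> u1; apply/eqP=> u0; move: u1; rewrite u0 /qform !mul0mx mxE => /eqP.
  by rewrite eq_sym oner_eq0.
pose F := 1 *: (dB *: A + (- dA) *: B) + (dA * pB - dB * pA) *: 1%:M.
pose G := 1 *: (dA *: A + dB *: B) + (- (dA * pA + dB * pB)) *: 1%:M.
have FE u : qform F u = dB * (qform A u - pA * qform 1%:M u) -
                        dA * (qform B u - pB * qform 1%:M u).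
  by rewrite /F !qform_lin; ring.
have GE u : qform G u = dA * (qform A u - pA * qform 1%:M u) +
                        dB * (qform B u - pB * qform 1%:M u).
  by rewrite /G !qform_lin; ring.
have [||||z z0 [Fz Gz]] := @common_zero R n F G x y n3 (neq0 _ x1) (neq0 _ y1).
- by rewrite FE x1 /pA /pB /dA /dB; ring.
- by rewrite FE y1 /pA /pB /dA /dB; ring.
- have -> : qform G x = - (t * (dA ^+ 2 + dB ^+ 2)).
    by rewrite GE x1 /pA /pB /dA /dB; ring.
  by rewrite oppr_le0 mulr_ge0 // ltW.
- have -> : qform G y = (1 - t) * (dA ^+ 2 + dB ^+ 2).
    by rewrite GE y1 /pA /pB /dA /dB; ring.
  by rewrite mulr_ge0 ?subr_ge0 // ltW.
have Az : qform A z = pA * qform 1%:M z.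
  apply/eqP; rewrite -subr_eq0; apply/eqP/(mulfI dd0); rewrite mulr0.
  transitivity (dB * qform F z + dA * qform G z); first by rewrite FE GE; ring.
  by rewrite Fz Gz !mulr0 addr0.
have Bz : qform B z = pB * qform 1%:M z.
  apply/eqP; rewrite -subr_eq0; apply/eqP/(mulfI dd0); rewrite mulr0.
  transitivity (dB * qform G z - dA * qform F z); first by rewrite FE GE; ring.
  by rewrite Fz Gz !mulr0 subr0.
have nz : 0 < qform 1%:M z by rewrite /qform mulmx1 row_sqr_norm_gt0.
have r2 : (Num.sqrt (qform 1%:M z))^-1 ^+ 2 * qform 1%:M z = 1.
  by rewrite exprVn sqr_sqrtr ?ltW // mulVf // gt_eqF.
exists ((Num.sqrt (qform 1%:M z))^-1 *: z).
by rewrite !qformZ r2 Az Bz !(mulrCA _ pA) !(mulrCA _ pB) r2 !mulr1.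
Qed.

(** * Two functionals on 3 x 3 rotations *)

(** The matrix of v |-> q v q^* on imaginary quaternions. Doubled entries are
written as sums so that each entry is visibly built from products of two
coordinates. *)
Definition quaternion_rotation (R : comRingType) (q : 'rV[R]_4) : 'M[R]_3 :=
  let a := q 0 0 in let b := q 0 1 in let c := q 0 2 in let d := q 0 3 in
  \matrix_(i, j) nth 0 (nth [::]
   [:: [:: a * a + b * b - c * c - d * d; (b * c - a * d) + (b * c - a * d);
           (b * d + a * c) + (b * d + a * c)];
       [:: (b * c + a * d) + (b * c + a * d); a * a - b * b + c * c - d * d;
           (c * d - a * b) + (c * d - a * b)];
       [:: (b * d - a * c) + (b * d - a * c);
           (c * d + a * b) + (c * d + a * b);
           a * a - b * b - c * c + d * d]] i) j.

Lemma sqr_norm4 (R : comRingType) (q : 'rV[R]_4) :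
  qform 1%:M q =
    q 0 0 * q 0 0 + q 0 1 * q 0 1 + q 0 2 * q 0 2 + q 0 3 * q 0 3.
Proof.
rewrite /qform mulmx1 mxE !big_ord_recl big_ord0 !mxE addr0 !addrA.
by do !congr (_ + _); congr (_ * _); congr (q _ _); apply: val_inj.
Qed.

(** For every q the product is the square of the squared norm of q, times the
identity; so the identity to check is homogeneous. *)
Lemma quaternion_rotation_orth (R : comRingType) (q : 'rV[R]_4) :
  qform 1%:M q = 1 -> quaternion_rotation q *m (quaternion_rotation q)^T = 1%:M.
Proof.
rewrite sqr_norm4 => q1.
have -> : 1%:M = (1 ^+ 2)%:M :> 'M[R]_3 by rewrite expr1n.
rewrite -q1; apply/matrixP=> i j; rewrite mxE !big_ord_recl big_ord0 !mxE /=.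
case: i => [[|[|[|//]]] Hi]; case: j => [[|[|[|//]]] Hj] /=;
  rewrite ?mulr1n ?mulr0n; ring.
Qed.

(** The determinant is the cube of the squared norm of the quaternion. *)
Lemma quaternion_rotation_det (R : comRingType) (q : 'rV[R]_4) :
  qform 1%:M q = 1 -> \det (quaternion_rotation q) = 1.
Proof.
rewrite sqr_norm4 => q1; rewrite -[RHS](expr1n _ 3) -[in RHS]q1.
rewrite (expand_det_row _ 0) !big_ord_recl big_ord0 /cofactor.
rewrite !(expand_det_row _ 0) !big_ord_recl !big_ord0 /cofactor !det_mx11.
rewrite !mxE /= /bump /=; ring.
Qed.

Definition quadratic (R : comRingType) n (f : 'rV[R]_n -> R) :=
  exists M, forall x, f x = qform M x.

Lemma quadratic_ext (R : comRingType) n (f g : 'rV[R]_n -> R) :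
  f =1 g -> quadratic g -> quadratic f.
Proof. by move=> fg [M gM]; exists M => x; rewrite fg. Qed.

Lemma quadraticD (R : comRingType) n (f g : 'rV[R]_n -> R) :
  quadratic f -> quadratic g -> quadratic (fun x => f x + g x).
Proof.
move=> [M fM] [N gN]; exists (M + N) => x.
by rewrite fM gN /qform mulmxDr mulmxDl mx_entryD.
Qed.

Lemma quadraticN (R : comRingType) n (f : 'rV[R]_n -> R) :
  quadratic f -> quadratic (fun x => - f x).
Proof.
by move=> [M fM]; exists (- M) => x; rewrite fM /qform mulmxN mulNmx mx_entryN.
Qed.

Lemma quadraticZ (R : comRingType) n (f : 'rV[R]_n -> R) c :
  quadratic f -> quadratic (fun x => f x * c).
Proof.
move=> [M fM]; exists (c *: M) => x.
by rewrite fM /qform -scalemxAr -scalemxAl mx_entryZ mulrC.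
Qed.

Lemma quadraticM (R : comRingType) n (i j : 'I_n) :
  quadratic (fun x : 'rV[R]_n => x 0 i * x 0 j).
Proof.
exists (delta_mx i j) => x.
rewrite /qform -(mul_delta_mx (0 : 'I_1)) mulmxA -colE -mulmxA -rowE.
by rewrite mxE big_ord1 !mxE.
Qed.

Lemma quadratic_sum (R : comRingType) n (I : finType) (f : I -> 'rV[R]_n -> R) :
  (forall i, quadratic (f i)) -> quadratic (fun x => \sum_i f i x).
Proof.
move=> /choice[M fM]; exists (\sum_i M i) => x.
rewrite /qform mulmx_sumr mulmx_suml summxE.
by apply: eq_bigr => i _; exact: fM.
Qed.

Lemma quaternion_rotation_quadratic (R : comRingType) l
    (Phi : {linear 'M[R]_3 -> 'rV[R]_l}) (j : 'I_l) :
  quadratic (fun q => Phi (quaternion_rotation q) 0 j).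
Proof.
have -> : (fun q => Phi (quaternion_rotation q) 0 j) = (fun q =>
   \sum_a \sum_b quaternion_rotation q a b * Phi (delta_mx a b) 0 j).
  apply: funext => q.
  rewrite [in LHS](matrix_sum_delta (quaternion_rotation q)).
  rewrite linear_sum summxE; apply: eq_bigr => a _.
  rewrite linear_sum summxE; apply: eq_bigr => b _.
  by rewrite linearZ mx_entryZ.
apply: quadratic_sum => a; apply: quadratic_sum => b; apply: quadraticZ.
case: a => [[|[|[|//]]] Ha]; case: b => [[|[|[|//]]] Hb] /=;
  (eapply quadratic_ext; [by move=> q; rewrite mxE; reflexivity|]) => /=;
  do ?[apply: quadraticD | apply: quadraticN | exact: quadraticM].
Qed.

(** The image of SO_3 is convex by Brickman's theorem and contains Phi(I) and
-Phi(I)/3, the mean of the values at the half turns about the three axes. *)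
Lemma special_orthogonal3_shrink (R : realType)
    (Phi : {linear 'M[R]_3 -> 'rV[R]_2}) (a : R) :
  0 <= a <= 1 -> exists2 V, special_orthogonal_group V & Phi V = a *: Phi 1%:M.
Proof.
move=> /andP[a0 a1].
have [A PA] := quaternion_rotation_quadratic Phi 0.
have [B PB] := quaternion_rotation_quadratic Phi 1.
pose e i : 'rV[R]_4 := delta_mx 0 i.
have e1 i : qform 1%:M (e i) = 1.
  by rewrite /qform mulmx1 /e trmx_delta mul_delta_mx mxE !eqxx.
have PE q : Phi (quaternion_rotation q) = \row_j (if j == 0 then qform A q
  else qform B q).
  apply/rowP=> j; rewrite mxE -PA -PB.
  by case: j => [[|[|//]] Hj] /=; congr (Phi _ _ _); apply: val_inj.
have rot0 : quaternion_rotation (e 0) = 1%:M.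
  apply/matrixP=> i j; rewrite !mxE.
  by case: i => [[|[|[|//]]] Hi]; case: j => [[|[|[|//]]] Hj] /=;
    rewrite ?mulr1n ?mulr0n; ring.
have rot123 : quaternion_rotation (e 1) + quaternion_rotation (e 2)
    + quaternion_rotation (e 3) = - 1%:M.
  apply/matrixP=> i j; rewrite !mxE.
  by case: i => [[|[|[|//]]] Hi]; case: j => [[|[|[|//]]] Hj] /=;
    rewrite ?mulr1n ?mulr0n; ring.
have mean (x y : 'rV[R]_4) t : 0 <= t <= 1 -> qform 1%:M x = 1 ->
  qform 1%:M y = 1 ->
    exists2 z, qform 1%:M z = 1 & Phi (quaternion_rotation z) =
      (1 - t) *: Phi (quaternion_rotation x) + t *: Phi (quaternion_rotation y).
  move=> t01 x1 y1; have [//|z [z1 zA zB]] := qforms_convex A B _ t01 x1 y1.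
  exists z => //; rewrite !PE; apply/rowP=> j; rewrite !mxE.
  by case: (j == 0).
have [|||u u1 uE] := @mean (e 1) (e 2) (1 / 2); [lra|exact: e1|exact: e1|].
have [|||v v1 vE] := @mean u (e 3) (1 / 3); [lra|exact: u1|exact: e1|].
(* (1 - t) - t / 3 = a for t = 3/4 (1 - a). *)
have [|||w w1 wE] := @mean (e 0) v (3 / 4 * (1 - a));
  [lra|exact: e1|exact: v1|].
have vE' : Phi (quaternion_rotation v) = (- (1 / 3)) *: Phi 1%:M.
  rewrite scaleNr -scalerN -linearN -rot123 !linearD vE uE.
  rewrite !scalerDr !scalerA.
  by congr (_ + _ + _); congr (_ *: _); field.
exists (quaternion_rotation w).
  have ww := quaternion_rotation_orth w1; split;
    last by rewrite quaternion_rotation_det.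
  by split => //; apply: mulmx1C.
by rewrite wE vE' rot0 scalerA -scalerDl; congr (_ *: _); field.
Qed.

(** * Clifford systems *)

(** The linear span of k anticommuting skew complex structures on R^N. Stating
the quadratic relation on the whole span is the polarised form of
E_i E_j + E_j E_i = - 2 delta_ij, and avoids handling the generators one by
one. *)
Definition clifford_system (R : comRingType) (N k : nat) : Prop :=
  exists E : {linear 'rV[R]_k -> 'M[R]_N}, forall c,
    (E c)^T = - E c /\ E c *m E c = - ((c *m c^T) 0 0)%:M.

Lemma clifford_systemW (R : comRingType) N k (E : 'rV[R]_k -> 'M[R]_N) :
  linear E -> (forall c, (E c)^T = - E c) ->
  (forall c, E c *m E c = - ((c *m c^T) 0 0)%:M) -> clifford_system R N k.
Proof.
move=> linE skewE sqrE.
pose F : {linear 'rV[R]_k -> 'M[R]_N} :=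
  HB.pack E (GRing.isLinear.Build R 'rV[R]_k 'M[R]_N *:%R E linE).
by exists F => c; split; [exact: skewE | exact: sqrE].
Qed.

Lemma clifford_system_trivial (R : comRingType) : clifford_system R 1 0.
Proof.
apply: (@clifford_systemW _ _ _ (fun=> 0)).
- by move=> a u v; rewrite scaler0 addr0.
- by move=> c; rewrite trmx0 oppr0.
- by move=> c; rewrite mul0mx mxE big_ord0 raddf0 oppr0.
Qed.

(** The structures E_i become diag(E_i, -E_i), and the standard symplectic
matrix (0, 1; -1, 0) anticommutes with all of them. *)
Lemma clifford_system_double (R : comRingType) N k :
  clifford_system R N k -> clifford_system R (N + N) (k + 1).
Proof.
case=> E EP; pose s (c : 'rV[R]_(k + 1)) := rsubmx c 0 0.
apply: (@clifford_systemW _ _ _ (fun c =>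
  block_mx (E (lsubmx c)) (s c)%:M (- (s c)%:M) (- E (lsubmx c)))).
- move=> a u v; rewrite scale_block_mx add_block_mx linearP /= linearP.
  have -> : s (a *: u + v) = a * s u + s v by rewrite /s linearP /= !mxE.
  by rewrite raddfD /= -scale_scalar_mx !scalerN !opprD.
- move=> c; have [tE _] := EP (lsubmx c).
  by rewrite tr_block_mx opp_block_mx !linearN /= tE !tr_scalar_mx !opprK.
- move=> c; have [_ EE] := EP (lsubmx c).
  rewrite mulmx_block !mulmxN !mulNmx EE opprK -!scalar_mxM.
  rewrite mul_scalar_mx mul_mx_scalar !subrr addNr.
  have -> : (c *m c^T) 0 0 = (lsubmx c *m (lsubmx c)^T) 0 0 + s c * s c.
    rewrite -{1 2}[c]hsubmxK tr_row_mx mul_row_col mx_entryD; congr (_ + _).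
    by rewrite mxE big_ord1 [_^T _ _]mxE.
  rewrite (@scalar_mx_block _ N N) opp_block_mx oppr0 !raddfD /=.
  by rewrite opprK [in LHS](addrC (- (s c * s c)%:M)).
Qed.

(** The three structures diag(J, -J), (0, J; J, 0) and (0, 1; -1, 0). Doubling
alone gives one structure fewer in the same dimension. *)
Lemma clifford_system_quaternion (R : comRingType) N :
  clifford_system R N 1 -> clifford_system R (N + N) 3.
Proof.
case=> E EP; pose J := E (const_mx 1).
have [tJ JJ] : J^T = - J /\ J *m J = - 1%:M.
  have [tJ JJ] := EP (const_mx 1); split=> //.
  by rewrite JJ mxE big_ord1 !mxE mulr1.
apply: (@clifford_systemW _ _ _ (fun c => block_mx
   (c 0 0 *: J) (c 0 1 *: J + (c 0 2)%:M)
   (c 0 1 *: J - (c 0 2)%:M) (- (c 0 0 *: J)))).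
- move=> a u v; rewrite scale_block_mx add_block_mx !mxE.
  rewrite !raddfD /= -!scale_scalar_mx !scalerDl !(scalerDr, scalerN) -!scalerA.
  by rewrite opprD; congr (block_mx _ _ _ _); apply: addrACA.
- move=> c; rewrite tr_block_mx opp_block_mx !linearD /= !linearN /=.
  by rewrite !linearZ /= tJ !tr_scalar_mx !opprK.
- move=> c; rewrite mulmx_block.
  have -> : (c *m c^T) 0 0 = c 0 0 * c 0 0 + c 0 1 * c 0 1 + c 0 2 * c 0 2.
    rewrite mxE !big_ord_recl big_ord0 !mxE addr0 !addrA.
    by do !congr (_ + _); congr (_ * _); congr (c _ _); apply: val_inj.
  have sqrJ x y : (x *: J) *m (y *: J) = - (x * y)%:M.
    by rewrite -scalemxAl -scalemxAr JJ !scalerN scalerA scale_scalar_mx mulr1.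
  have sclJ x y : (x *: J) *m y%:M = (y * x) *: J.
    by rewrite mul_mx_scalar scalerA.
  have sclJ' x y : x%:M *m (y *: J) = (x * y) *: J.
    by rewrite mul_scalar_mx scalerA.
  rewrite !(mulmxDl, mulmxDr, mulmxN, mulNmx) !sqrJ !sclJ !sclJ' -!scalar_mxM.
  rewrite (@scalar_mx_block _ N N) opp_block_mx oppr0 !raddfD /=.
  rewrite (mulrC (c 0 1) (c 0 0)) !opprK; congr (block_mx _ _ _ _).
  + by rewrite [X in _ + X = _]addrA subrK addrA.
  + by rewrite addrACA addNr subrr addr0.
  + by rewrite addrACA addNr addNr addr0.
  + by rewrite addrA addrK [LHS]addrC addrA.
Qed.

Lemma clifford_system4 (R : comRingType) : clifford_system R 4 3.
Proof.
apply: (@clifford_system_quaternion R 2).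
apply: (@clifford_system_double R 1 0).
exact: clifford_system_trivial.
Qed.

Lemma clifford_system_pow2 (R : comRingType) l :
  (3 <= l)%N -> clifford_system R (2 ^ (l - 1)) l.
Proof.
move=> /subnK <-; elim: (l - 3)%N => [|k IH]; first exact: clifford_system4.
have := clifford_system_double IH.
rewrite addnn -mul2n -expnS addn1 -subSn ?addn3 //.
Qed.

Lemma clifford_system_sub (R : comRingType) N k :
  clifford_system R N (k + 1) -> clifford_system R N k.
Proof.
case=> E EP; apply: (@clifford_systemW _ _ _ (fun c => E (row_mx c 0))).
- by move=> a u v; rewrite -linearP scale_row_mx add_row_mx scaler0 addr0.
- by move=> c; have [] := EP (row_mx c 0).
- move=> c; have [_ ->] := EP (row_mx c 0).
  by rewrite tr_row_mx mul_row_col trmx0 mul0mx addr0.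
Qed.

(** The linear map c |-> Psi (E c) goes from R^l to R^l: either it is
invertible, and hits Psi 1, or it has a nonzero kernel vector, and mu = 0. The
sign of mu is adjusted by replacing J by -J. *)
Lemma complex_structure_on_ray (R : rcfType) N l
    (Psi : {linear 'M[R]_N -> 'rV[R]_l}) :
  clifford_system R N l -> Psi 1%:M != 0 ->
  exists J mu, [/\ J^T = - J, J *m J = - 1%:M,
    mu <= 0 & Psi J = mu *: Psi 1%:M].
Proof.
case=> E EP Psi1.
suff [c [mu [c0 cE]]] : exists c mu, c != 0 /\ Psi (E c) = mu *: Psi 1%:M.
  have cc : 0 < (c *m c^T) 0 0 by exact: row_sqr_norm_gt0.
  pose r := (Num.sqrt ((c *m c^T) 0 0))^-1.
  have r2 : r * r * (c *m c^T) 0 0 = 1.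
    by rewrite -expr2 exprVn sqr_sqrtr ?ltW // mulVf // gt_eqF.
  have [tE EE] := EP c.
  have scaled t : t * t * (c *m c^T) 0 0 = 1 -> t * mu <= 0 ->
      exists J mu, [/\ J^T = - J, J *m J = - 1%:M, mu <= 0 &
                      Psi J = mu *: Psi 1%:M].
    move=> t2 tmu; exists (t *: E c), (t * mu); split=> //.
    - by rewrite [LHS]linearZ /= tE scalerN.
    - by rewrite -scalemxAl -scalemxAr scalerA EE scalerN scale_scalar_mx t2.
    - by rewrite [LHS]linearZ /= cE scalerA.
  have r0 : 0 <= r by rewrite invr_ge0 sqrtr_ge0.
  have [mu0|/ltW mu0] := leP mu 0.
    by apply: (scaled r) => //; rewrite mulr_ge0_le0.
  by apply: (scaled (- r)); rewrite ?mulrNN // mulNr oppr_le0 mulr_ge0.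
pose M := lin1_mx (Psi \o E).
have ME c : c *m M = Psi (E c) by rewrite mul_rV_lin1.
have [uM|] := boolP (M \in unitmx).
  exists (Psi 1%:M *m invmx M), 1; rewrite -ME mulmxKV // scale1r; split=> //.
  by apply: contraNneq Psi1 => c0; rewrite -(mulmxKV uM (Psi 1%:M)) c0 mul0mx.
rewrite -row_free_unit -kermx_eq0 => /rowV0Pn[c /sub_kermxP cM c0].
by exists c, 0; rewrite -ME cM scale0r.
Qed.

(** * Rotations of a block of coordinates *)

Lemma special_orthogonal1 (R : realType) n : special_orthogonal_group
    (1%:M : 'M[R]_n).
Proof. by split; [split; rewrite trmx1 mulmx1 | rewrite det1]. Qed.

Lemma orthogonalM (R : realType) n (U V : 'M[R]_n) :
  orthogonal_group U -> orthogonal_group V -> orthogonal_group (U *m V).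
Proof.
move=> [U1 U2] [V1 V2]; split; rewrite trmx_mul mulmxA.
- by rewrite -(mulmxA V^T) U1 mulmx1.
- by rewrite -(mulmxA U) V2 mulmx1.
Qed.

Lemma special_orthogonalM (R : realType) n
    (U V : 'M[R]_n) : special_orthogonal_group U ->
  special_orthogonal_group V -> special_orthogonal_group (U *m V).
Proof.
by move=> [U1 U2] [V1 V2]; split;
  [exact: orthogonalM | rewrite det_mulmx mulr_gt0].
Qed.

(** When [J] is a complex structure on the range of the projection [Pi], this is
the rotation cos t + J sin t on that range, and the identity on its orthogonal
complement, for a = cos t and b = sin t. *)
Definition partial_rotation (R : pzRingType) n (Pi J : 'M[R]_n) (a b : R) :=
  1%:M + (a - 1) *: Pi + b *: J.

Section PartialRotation.
Variables (R : realType) (n : nat) (Pi J : 'M[R]_n).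
Hypotheses (tPi : Pi^T = Pi) (tJ : J^T = - J) (PiPi : Pi *m Pi = Pi).
Hypotheses (PiJ : Pi *m J = J) (JPi : J *m Pi = J) (JJ : J *m J = - Pi).

Local Notation rot := (partial_rotation Pi J).

Lemma partial_rotationM a b c d :
  rot a b *m rot c d = rot (a * c - b * d) (a * d + b * c).
Proof.
rewrite /partial_rotation !mulmxDl !mulmxDr !(mul1mx, mulmx1).
rewrite -!(scalemxAl, scalemxAr) PiPi PiJ JPi JJ.
by apply/matrixP=> i j; rewrite !mxE; ring.
Qed.

Lemma tr_partial_rotation a b : (rot a b)^T = rot a (- b).
Proof.
by apply/matrixP=> i j; rewrite /partial_rotation; have /matrixP/(_ i j) := tJ;
  have /matrixP/(_ i j) := tPi; rewrite !mxE eq_sym => -> ->; ring.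
Qed.

Lemma partial_rotation10 : rot 1 0 = 1%:M.
Proof. by rewrite /partial_rotation subrr !scale0r !addr0. Qed.

Lemma partial_rotation_orth a b : a ^+ 2 + b ^+ 2 = 1 -> orthogonal_group
    (rot a b).
Proof.
move=> ab; split; rewrite tr_partial_rotation partial_rotationM;
  by rewrite -partial_rotation10 -ab; congr (rot _ _); ring.
Qed.

(** The determinant is positive because the rotation is the square of the
rotation by half the angle, whose cosine is c and sine d. *)
Lemma partial_rotation_SO a b : a ^+ 2 + b ^+ 2 = 1 -> -1 < a ->
  special_orthogonal_group (rot a b).
Proof.
move=> ab a1; split; first exact: partial_rotation_orth.
pose c := Num.sqrt ((1 + a) / 2); pose d := b / (2 * c).
have c2 : c ^+ 2 = (1 + a) / 2 by rewrite sqr_sqrtr //; lra.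
have c0 : c != 0 by rewrite -sqrf_eq0 c2; apply/eqP; lra.
have d2 : d ^+ 2 = (1 - a) / 2.
  rewrite /d expr_div_n exprMn c2.
  have -> : b ^+ 2 = (1 - a) * (1 + a) by move: ab; lra.
  by field; apply/eqP; lra.
have -> : rot a b = rot c d *m rot c d.
  by rewrite partial_rotationM; congr (rot _ _);
    [rewrite -!expr2 c2 d2 | rewrite /d]; field.
rewrite det_mulmx -expr2 exprn_even_gt0 //= -unitfE -/(unitmx _).
have [_ /mulmx1_unit[]//] : orthogonal_group (rot c d).
by apply: partial_rotation_orth; rewrite c2 d2; field.
Qed.

(** The displacement is controlled by 1 - a alone, uniformly in [J]. *)
Lemma partial_rotation_dist a b : a ^+ 2 + b ^+ 2 = 1 ->
  (rot a b - 1%:M) *m (rot a b - 1%:M)^T = (2 * (1 - a)) *: Pi.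
Proof.
move=> ab; rewrite [(_ - _)^T]linearB /= trmx1 tr_partial_rotation.
rewrite mulmxBl !mulmxBr !(mul1mx, mulmx1) partial_rotationM /partial_rotation.
have -> : a * a - b * - b = 1 by rewrite -ab; ring.
by apply/matrixP=> i j; rewrite !mxE; ring.
Qed.

End PartialRotation.

(** The complex structure J of the block is chosen with
Phi(P^T J P V) = mu Phi(P^T P V), mu <= 0, so rotating [V] by (a, b) changes
Phi(V) by (a - 1 + mu b) Phi(P^T P V). The line a + mu b = 1 - e meets the
unit circle in the quadrant a, b >= 0, and there 1 - a <= e, as mu b <= 0. *)
Lemma shrink_block (R : realType) (N n l : nat) (P : 'M[R]_(N, n))
    (Phi : {linear 'M[R]_n -> 'rV[R]_l}) (V : 'M[R]_n) (e : R) :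
  clifford_system R N l -> P *m P^T = 1%:M -> special_orthogonal_group V ->
  0 <= e <= 1 ->
  exists W, [/\ special_orthogonal_group W,
     Phi W = Phi V - e *: Phi (P^T *m P *m V) &
     forall i j, (W - V) i j ^+ 2 <= 2 * e].
Proof.
move=> cl PP SV /andP[e0 e1]; set Pi := P^T *m P.
have [Phi0|Phi0] := eqVneq (Phi (Pi *m V)) 0.
  exists V; rewrite Phi0 scaler0 subr0; split=> // i j.
  by rewrite subrr mxE expr0n /= mulr_ge0.
pose Psi0 (X : 'M[R]_N) := Phi (P^T *m X *m P *m V).
have linPsi : linear Psi0.
  move=> a X Y; rewrite /Psi0 mulmxDr !mulmxDl -scalemxAr -!scalemxAl.
  by rewrite linearP.
pose Psi : {linear 'M[R]_N -> 'rV[R]_l} :=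
  HB.pack Psi0 (GRing.isLinear.Build R 'M[R]_N 'rV[R]_l *:%R Psi0 linPsi).
have Psi1 : Psi 1%:M = Phi (Pi *m V) by rewrite /= /Psi0 mulmx1.
have [|J [mu [tJ JJ mu0 PsiJ]]] := complex_structure_on_ray (Psi := Psi) cl.
  by rewrite Psi1.
rewrite Psi1 in PsiJ.
pose K := P^T *m J *m P.
have tPi : Pi^T = Pi by rewrite /Pi trmx_mul trmxK.
have tK : K^T = - K by rewrite /K !trmx_mul trmxK tJ mulNmx mulmxN mulmxA.
have PiPi : Pi *m Pi = Pi by rewrite /Pi !mulmxA -(mulmxA P^T) PP mulmx1.
have PiK : Pi *m K = K by rewrite /Pi /K !mulmxA -(mulmxA P^T) PP mulmx1.
have KPi : K *m Pi = K by rewrite /Pi /K !mulmxA -(mulmxA (_ *m J)) PP mulmx1.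
have KK : K *m K = - Pi.
  by rewrite /Pi /K !mulmxA -(mulmxA (_ *m J)) PP mulmx1 -(mulmxA P^T) JJ
    mulmxN mulmx1 mulNmx.
have [b [b0 b2 be]] : exists b, [/\ 0 <= b,
  (1 - e - mu * b) ^+ 2 + b ^+ 2 = 1 & b <= 1].
  pose p : {poly R} := ((1 - e)%:P - mu%:P * 'X) ^+ 2 + 'X ^+ 2 - 1%:P.
  have pE s : p.[s] = (1 - e - mu * s) ^+ 2 + s ^+ 2 - 1 by rewrite /p !hornerE.
  have [|b b01 /rootP] := @poly_ivt R p 0 1 ler01.
    by rewrite !pE; apply/andP; split; nra.
  rewrite pE => /eqP; rewrite subr_eq0 => /eqP b2.
  by case/andP: b01 => b0 b1; exists b; split.
pose a := 1 - e - mu * b.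
have a1 : 1 - e <= a by rewrite /a; nra.
have ai : a <= 1 by move: b2; rewrite -/a; nra.
exists (partial_rotation Pi K a b *m V); split.
- apply: special_orthogonalM => //; apply: partial_rotation_SO => //; lra.
- rewrite /partial_rotation !mulmxDl mul1mx -!scalemxAl !linearD /= !linearZ /=.
  have -> : Phi (K *m V) = mu *: Phi (Pi *m V) by rewrite -PsiJ.
  rewrite scalerA -addrA -scalerDl scalerN -scaleNr; congr (_ + _ *: _).
  by rewrite /a; ring.
- move=> i j; set D := partial_rotation Pi K a b - 1%:M.
  have -> : partial_rotation Pi K a b *m V - V = D *m V by rewrite mulmxBl
    mul1mx.
  have DD : (D *m V) *m (D *m V)^T = (2 * (1 - a)) *: Pi.
    case: SV => [[_ VV] _]; rewrite trmx_mul !mulmxA -(mulmxA D) VV mulmx1.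
    exact: partial_rotation_dist.
  apply: (le_trans (sqr_entry_le_gram _ _ _)); rewrite DD mx_entryZ.
  have : Pi i i ^+ 2 <= Pi i i.
    by have := sqr_entry_le_gram Pi i i; rewrite tPi PiPi.
  move: (Pi i i) => p pp; have p1 : p <= 1 by nra.
  have : (1 - a) * p <= 1 - a by rewrite ler_piMr // subr_ge0.
  lra.
Qed.

(** * Shrinking all coordinates in turn *)

(** The matrix restricting a vector to the [N] consecutive coordinates from [j]
on, counted cyclically. *)
Definition cyclic_window (R : pzRingType) N n (j : 'I_n.+1) : 'M[R]_(N, n.+1) :=
  \matrix_(i, k) (k == inord i + j)%:R.

Lemma cyclic_window_orth (R : pzRingType) N n (j : 'I_n.+1) : (N <= n.+1)%N ->
  cyclic_window R N j *m (cyclic_window R N j)^T = 1%:M.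
Proof.
move=> Nn; apply/matrixP=> i i';
  rewrite !mxE (bigD1 (inord i + j)) //= !mxE eqxx mul1r.
rewrite big1 ?addr0 => [|k /negbTE kN]; last by rewrite mxE kN mul0r.
congr (_%:R); congr (nat_of_bool _).
rewrite (inj_eq (addIr j)) -val_eqE /= !inordK ?(leq_trans (ltn_ord _) Nn) //.
Qed.

(** Every coordinate lies in exactly [N] of the windows. *)
Lemma sum_cyclic_windows (R : pzRingType) N n :
  \sum_j (cyclic_window R N j)^T *m cyclic_window R N j = N%:R%:M :> 'M[R]_n.+1.
Proof.
apply/matrixP=> a b; rewrite summxE; under eq_bigr do rewrite mxE.
rewrite exchange_big /=.
transitivity (\sum_(i < N) (a == b)%:R : R); last first.
  by rewrite sumr_const card_ord mxE; case: (a == b); rewrite ?mul0rn.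
apply: eq_bigr => i _; rewrite (bigD1 (a - inord i)) //= !mxE.
rewrite [inord i + _]addrC subrK eqxx mul1r [b == a]eq_sym.
rewrite big1 ?addr0 // => j jN.
rewrite !mxE; case: eqP => [aE|_]; last by rewrite mul0r.
by move: jN; rewrite aE addrC addKr eqxx.
Qed.

Lemma linear_entry_bound (R : realType) m n l
    (f : {linear 'M[R]_(m, n) -> 'rV[R]_l}) :
  exists2 C : R, 0 <= C & forall (X : 'M[R]_(m, n)) t,
    (forall i j, `|X i j| <= t) -> `|f X| <= C * t.
Proof.
exists (\sum_i \sum_j `|f (delta_mx i j)|).
  by rewrite sumr_ge0 // => i _; rewrite sumr_ge0.
move=> X t Xt; rewrite {1}[X]matrix_sum_delta linear_sum mulr_suml.
apply: (le_trans (ler_norm_sum _ _ _)); apply: ler_sum => i _.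
rewrite linear_sum mulr_suml.
apply: (le_trans (ler_norm_sum _ _ _)); apply: ler_sum => j _.
by rewrite linearZ /= normrZ mulrC ler_wpM2l.
Qed.

(** Each block is shrunk exactly at the current matrix W instead of V; as W - V
is of order sqrt e, this substitution costs e times a multiple of sqrt e. The
constant depends on [Phi] and the blocks, but not on [V]. *)
Lemma shrink_blocks (R : realType) N n l (s : seq 'M[R]_(N, n))
    (Phi : {linear 'M[R]_n -> 'rV[R]_l}) :
  clifford_system R N l -> (forall P, P \in s -> P *m P^T = 1%:M) ->
  exists2 C : R, 0 <= C & forall V e, special_orthogonal_group V ->
    0 <= e <= 1 ->
  exists W, [/\ special_orthogonal_group W,
    `|Phi W - Phi V + e *: Phi ((\sum_(P <- s) P^T *m P) *m V)|
      <= C * (e * Num.sqrt (2 * e)) &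
    forall i j, `|(W - V) i j| <= (size s)%:R * Num.sqrt (2 * e)].
Proof.
move=> cl; elim: s => [_|P s IH Ps].
  exists 0 => // V e SV e01; exists V; rewrite subrr big_nil mul0mx linear0.
  by rewrite scaler0 addr0 normr0 mul0r; split=> // i j;
    rewrite subrr mxE normr0 mul0r.
have [|C C0 {}IH] := IH; first by move=> Q Qs; apply: Ps;
  rewrite in_cons Qs orbT.
pose f0 X := Phi (P^T *m P *m X).
have linf : linear f0.
  by move=> a X Y; rewrite /f0 mulmxDr -scalemxAr linearP.
pose f : {linear 'M[R]_n -> 'rV[R]_l} :=
  HB.pack f0 (GRing.isLinear.Build R 'M[R]_n 'rV[R]_l *:%R f0 linf).
have [D D0 fD] := linear_entry_bound f.
exists (C + D * (size s)%:R); first by rewrite addr_ge0 // mulr_ge0.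
move=> V e SV e01; have /andP[e0 _] := e01.
have [W [SW WV dW]] := IH V e SV e01.
have [|U [SU UW dU]] := shrink_block Phi cl _ SW e01 (P := P).
  by apply: Ps; rewrite mem_head.
exists U; split=> //.
- rewrite big_cons mulmxDl linearD /= UW.
  have -> : Phi W - e *: Phi (P^T *m P *m W) - Phi V +
      e *: (Phi (P^T *m P *m V) + Phi ((\sum_(P <- s) P^T *m P) *m V)) =
      Phi W - Phi V + e *: Phi ((\sum_(P <- s) P^T *m P) *m V) - e *: f (W - V).
    rewrite /= /f0 mulmxBr linearB /= scalerBr scalerDr opprB.
    by apply/rowP=> k; rewrite !mxE; ring.
  apply: (le_trans (ler_normB _ _)); rewrite mulrDl lerD //.
  rewrite normrZ (ger0_norm e0).
  have -> : D * (size s)%:R * (e * Num.sqrt (2 * e)) =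
            e * (D * ((size s)%:R * Num.sqrt (2 * e))) by ring.
  by rewrite ler_wpM2l // fD.
- move=> i j; have -> : U - V = (U - W) + (W - V) by rewrite addrA subrK.
  rewrite mxE; apply: (le_trans (ler_normD _ _)).
  rewrite /= -add1n natrD mulrDl mul1r lerD //.
  by rewrite -sqrtr_sqr ler_wsqrtr.
Qed.

Lemma shrink_round (R : realType) N n l (Phi : {linear 'M[R]_n -> 'rV[R]_l}) :
  clifford_system R N l -> (0 < N <= n)%N ->
  exists2 C : R, 0 <= C & forall V d, special_orthogonal_group V ->
    0 <= d <= 1 ->
  exists2 W, special_orthogonal_group W &
    `|Phi W - (1 - d) *: Phi V| <= C * (d * Num.sqrt d).
Proof.
case: n Phi => [|n] Phi cl /andP[N0 Nn]; first by rewrite leqNgt N0 in Nn.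
pose s := [seq cyclic_window R N j | j <- enum 'I_n.+1].
have [|C C0 H] := shrink_blocks (s := s) Phi cl.
  by move=> P /mapP[j _ ->]; exact: cyclic_window_orth.
exists (C * Num.sqrt 2); first by rewrite mulr_ge0 // sqrtr_ge0.
move=> V d SV /andP[d0 d1].
have N1 : 1 <= N%:R :> R by rewrite ler1n.
have NN0 : N%:R != 0 :> R by rewrite pnatr_eq0 -lt0n.
have dN : d / N%:R <= d by rewrite ler_pdivrMr ?ler_peMr // ltr0n.
have dN0 : 0 <= d / N%:R by rewrite divr_ge0.
have [|W [SW WV _]] := H V (d / N%:R) SV; first by rewrite dN0 (le_trans dN).
exists W => //; move: WV; rewrite big_map big_enum /= sum_cyclic_windows.
rewrite mul_scalar_mx linearZ /= scalerA divfK // scalerBl scale1r opprB.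
rewrite addrAC addrA => /le_trans; apply.
have -> : C * Num.sqrt 2 * (d * Num.sqrt d) =
    C * (d * (Num.sqrt 2 * Num.sqrt d)) by ring.
by rewrite -sqrtrM // ler_wpM2l // ler_pM ?sqrtr_ge0 // ler_wsqrtr // ler_wpM2l.
Qed.

(** * The Euler scheme for x' = - x *)

(** If every point of [K] can be moved within [K] by a step [d] towards 0, up to
an error o(d), then a large number of small steps follows the segment to 0. *)
Section EulerScheme.
Variables (R : realType) (E : normedModType R) (K : set E) (C : R).
Hypothesis C0 : 0 <= C.
Hypothesis step : forall x d, K x -> 0 <= d <= 1 ->
  exists2 y, K y & `|y - (1 - d) *: x| <= C * (d * Num.sqrt d).

Lemma euler_iterate x d k : K x -> 0 <= d <= 1 ->
  exists2 y, K y & `|y - (1 - d) ^+ k *: x| <= k%:R * (C * (d * Num.sqrt d)).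
Proof.
move=> Kx d01; have /andP[d0 d1] := d01; elim: k => [|k [y Ky yx]].
  by exists x => //; rewrite expr0 scale1r subrr normr0 mul0r.
have [z Kz zy] := step Ky d01; exists z => //.
have -> : z - (1 - d) ^+ k.+1 *: x =
    (z - (1 - d) *: y) + (1 - d) *: (y - (1 - d) ^+ k *: x).
  by rewrite scalerBr scalerA -exprS addrA subrK.
apply: (le_trans (ler_normD _ _)); rewrite -add1n natrD mulrDl mul1r lerD //.
rewrite normrZ ger0_norm ?subr_ge0 //; apply: le_trans yx.
by rewrite ler_piMl // gerBl.
Qed.

(** Bernoulli's inequality (1 + d)^k >= 1 + k d, combined with
(1 - d) (1 + d) <= 1. *)
Lemma expr_onem_bernoulli (d : R) k : 0 <= d <= 1 -> (1 - d) ^+ k *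
    (1 + k%:R * d) <= 1.
Proof.
move=> /andP[d0 d1]; elim: k => [|k IH];
  first by rewrite expr0 mul0r addr0 mul1r.
apply: le_trans IH; rewrite exprSr -mulrA ler_wpM2l ?exprn_ge0 ?subr_ge0 //.
have k0 : 0 <= k%:R :> R by [].
by rewrite -natr1; nra.
Qed.

(** Take [k] steps of the length [d] for which (1 - d)^k = a. Then k d <= 1 / a,
so the total error is at most (C / a) sqrt d, with d <= 1 / (a k). *)
Lemma euler_approx_pos x a eta : K x -> 0 < a <= 1 -> 0 < eta ->
  exists2 y, K y & `|y - a *: x| <= eta.
Proof.
move=> Kx /andP[a0 a1] eta0.
pose B := (C / a) ^+ 2 / (a * eta ^+ 2).
have B0 : 0 <= B by rewrite /B divr_ge0 ?sqr_ge0 // mulr_ge0 ?sqr_ge0 // ltW.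
pose k := (Num.bound B).+1.
have kB : B <= k%:R.
  by apply/ltW/(lt_trans (archi_boundP B0)); rewrite ltr_nat.
have k0 : 0 < k%:R :> R by rewrite ltr0n.
have [|s s01 /rootP] := @poly_ivt R ('X ^+ k - a%:P) 0 1 ler01.
  by rewrite !hornerE expr1n expr0n /= add0r oppr_le0 (ltW a0) subr_ge0.
rewrite !hornerE => /eqP; rewrite subr_eq0 => /eqP sk.
have /andP[s0 s1] := s01.
pose d := 1 - s.
have d01 : 0 <= d <= 1 by rewrite /d; lra.
have /andP[d0 d1] := d01.
have sd : 1 - d = s by rewrite /d; ring.
have kd : k%:R * d <= a^-1.
  have := expr_onem_bernoulli k d01; rewrite sd sk mulrC -ler_pdivlMr // div1r.
  by apply: le_trans; rewrite lerDr.
have [y Ky yx] := euler_iterate k Kx d01; exists y => //.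
move: yx; rewrite sd sk => /le_trans; apply.
have -> : k%:R * (C * (d * Num.sqrt d)) = C * (k%:R * d) * Num.sqrt d by ring.
apply: (@le_trans _ _ (C / a * Num.sqrt d)).
  by rewrite ler_wpM2r ?sqrtr_ge0 // ler_wpM2l.
rewrite -(ler_pXn2r (n := 2)) ?nnegrE ?mulr_ge0 ?sqrtr_ge0 ?invr_ge0 ?(ltW a0)
  ?(ltW eta0) //.
rewrite exprMn sqr_sqrtr //.
have : (C / a) ^+ 2 <= k%:R * (a * eta ^+ 2).
  by rewrite -ler_pdivrMr // mulr_gt0 // exprn_gt0.
have dk : d <= (a * k%:R)^-1.
  by rewrite invfM ler_pdivlMr // mulrC.
move=> H; apply: (@le_trans _ _ ((C / a) ^+ 2 * (a * k%:R)^-1)).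
  by rewrite ler_wpM2l ?sqr_ge0.
rewrite ler_pdivrMr ?mulr_gt0 //; apply: (le_trans H).
by rewrite le_eqVlt; apply/orP; left; apply/eqP; ring.
Qed.

Lemma euler_star_shaped : closed K -> forall x a, K x -> 0 <= a <= 1 -> K
    (a *: x).
Proof.
move=> clK x a Kx /andP[a0 a1]; apply: clK => B /nbhs_ballP[eta /= eta0 etaB].
(* The scale a = 0 takes infinitely many steps; a small positive one replaces
   it. *)
pose b := Num.max a (eta / 4 / (`|x| + eta)).
have xe : 0 < `|x| + eta by rewrite ltr_wpDl.
have be : 0 < eta / 4 / (`|x| + eta) by rewrite !divr_gt0.
have b01 : 0 < b <= 1.
  rewrite lt_max be orbT ge_max a1 /= ler_pdivrMr // mul1r.
  have := normr_ge0 x; lra.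
have bx : `|(b - a) *: x| <= eta / 4.
  rewrite normrZ ger0_norm ?subr_ge0 ?le_max ?lexx //.
  have [ba|ba] : b = a \/ b <= eta / 4 / (`|x| + eta).
    by rewrite /b; case: (leP a) => h; [right|left].
  - by rewrite ba subrr mul0r divr_ge0 // ltW.
  - apply: (@le_trans _ _ (eta / 4 / (`|x| + eta) * (`|x| + eta))).
      apply: ler_pM => //; rewrite ?subr_ge0 ?le_max ?lexx //.
        by rewrite (le_trans _ ba) // gerBl.
      by rewrite lerDl ltW.
    by rewrite divfK // gt_eqF.
have [|y Ky yx] := euler_approx_pos (eta := eta / 4) Kx b01;
  first by rewrite divr_gt0.
exists y; split=> //; apply: etaB; rewrite -ball_normE /=.
have -> : a *: x - y = - ((y - b *: x) + (b - a) *: x).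
  by rewrite scalerBl addrA subrK opprB.
rewrite normrN; apply: (le_lt_trans (ler_normD _ _)).
by apply: (le_lt_trans (lerD yx bx)); lra.
Qed.

End EulerScheme.

(** * Compactness of the special orthogonal group *)

Lemma continuous_sumr (R : realType) (T : topologicalType) (I : finType)
    (f : I -> T -> R) :
  (forall i, continuous (f i)) -> continuous (fun x => \sum_i f i x).
Proof.
by move=> fc; apply: continuous_big => //; exact: add_continuous.
Qed.

Lemma continuous_prodr (R : realType) (T : topologicalType) (I : finType)
    (f : I -> T -> R) :
  (forall i, continuous (f i)) -> continuous (fun x => \prod_i f i x).
Proof.
by move=> fc; apply: continuous_big => //; exact: mul_continuous.
Qed.

(** The condition on the determinant becomes a closed one. *)
Lemma special_orthogonal_det1 (R : realType) n (V : 'M[R]_n) :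
  special_orthogonal_group V <-> V *m V^T = 1%:M /\ \det V = 1.
Proof.
split=> [[[_ VV] dV]|[VV dV]]; last first.
  by split; [split=> //; exact: mulmx1C | rewrite dV].
split=> //; apply/eqP; rewrite -(eqrXn2 (n := 2)) ?ltW // expr1n.
by rewrite expr2 -{2}det_tr -det_mulmx VV det1.
Qed.

(** Matrices are identified with their row vectors of coordinates, so that it
suffices to see that the entries are bounded and the equations closed. *)
Lemma compact_special_orthogonal (R : realType) n :
  compact
    [set v : 'rV[R]_(n * n) | special_orthogonal_group (vec_mx v : 'M[R]_n)].
Proof.
have entry i j : continuous (fun v : 'rV[R]_(n * n) =>
  (vec_mx v : 'M[R]_n) i j).
  have -> : (fun v : 'rV[R]_(n * n) => (vec_mx v : 'M[R]_n) i j) =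
            (fun v => v 0 (mxvec_index i j)).
    by apply: funext => v; rewrite mxE.
  exact: coord_continuous.
have mulc (T : topologicalType) (f g : T -> R) :
    continuous f -> continuous g -> continuous (fun x => f x * g x).
  by move=> fc gc x; exact: (continuousM (fc x) (gc x)).
apply: bounded_closed_compact.
  exists 1; split=> // M M1 v [[_ VV] _].
  rewrite /= [leLHS]/Num.norm /= mx_normrE; apply: bigmax_le => [|[i k] _ /=].
    by rewrite (le_trans ler01) // ltW.
  apply: le_trans (ltW M1); rewrite (ord1 i).
  case/mxvec_indexP: k => a b; rewrite -[v]vec_mxK mxvecE.
  rewrite -(expr_le1 (n := 2)) // real_normK ?num_real //.
  by rewrite (le_trans (sqr_entry_le_gram _ _ _)) // VV mxE eqxx.
have -> :
  [set v : 'rV[R]_(n * n) | special_orthogonal_group (vec_mx v : 'M[R]_n)] =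
  (\bigcap_(p in [set: 'I_n * 'I_n])
     (fun v => ((vec_mx v : 'M[R]_n) *m (vec_mx v)^T) p.1 p.2)
       @^-1` [set x | x = (p.1 == p.2)%:R])
  `&` (fun v => \det (vec_mx v : 'M[R]_n)) @^-1` [set x | x = 1].
  apply/seteqP; split=> v.
    by move=> /special_orthogonal_det1[VV dV]; split=> // p _ /=;
      rewrite VV mxE.
  move=> [VV dV]; apply/special_orthogonal_det1; split=> //.
  by apply/matrixP=> i j; rewrite [RHS]mxE; exact: (VV (i, j) I).
apply: closedI.
  apply: closed_bigI => -[i j] _ /=; apply: preimage_closed;
    last exact: closed_eq.
  move=> v _; move: v.
  have -> : (fun v : 'rV[R]_(n * n) =>
    ((vec_mx v : 'M[R]_n) *m (vec_mx v)^T) i j) =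
     fun v => \sum_k (vec_mx v : 'M[R]_n) i k * (vec_mx v : 'M[R]_n) j k.
    by apply: funext => v; rewrite mxE; apply: eq_bigr => k _;
      rewrite [_^T _ _]mxE.
  apply: continuous_sumr => k; apply: mulc; exact: entry.
apply: preimage_closed; last exact: closed_eq.
move=> v _; move: v; apply: continuous_sumr => s.
apply: mulc; first exact: cst_continuous.
by apply: continuous_prodr => i; exact: entry.
Qed.

Lemma closed_special_orthogonal_image (R : realType) n l
    (Phi : {linear 'M[R]_n -> 'rV[R]_l}) :
  closed (Phi @` (@special_orthogonal_group R n)).
Proof.
pose f : {linear 'rV[R]_(n * n) -> 'rV[R]_l} := (Phi \o vec_mx)%FUN.
have -> : Phi @` (@special_orthogonal_group R n) =
  f @` [set v : 'rV[R]_(n * n) | special_orthogonal_group (vec_mx v : 'M[R]_n)].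
  apply/seteqP; split=> [_ [V SV <-]|_ [v Sv <-]]; last by exists (vec_mx v).
  by exists (mxvec V) => /=; rewrite mxvecK.
apply: compact_closed; first exact: norm_hausdorff.
apply: continuous_compact; last exact: compact_special_orthogonal.
apply: continuous_subspaceT; apply: bounded_linear_continuous.
apply/linear_boundedP; have [C C0 fC] := linear_entry_bound f.
near=> r => x; apply: (@le_trans _ _ (C * `|x|)).
  apply: fC => i j; rewrite [leRHS]/Num.norm /= mx_normrE.
  by apply/bigmax_geP; right; exists (i, j).
by rewrite ler_wpM2r //; near: r; apply: nbhs_pinfty_ge; rewrite num_real.
Unshelve. all: by end_near. Qed.

(** * Star-shapedness *)

Lemma special_orthogonal_shrink (R : realType) n l
    (Phi : {linear 'M[R]_n -> 'rV[R]_l}) a :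
  (l = 2%N /\ (3 <= n)%N) \/ ((3 <= l)%N /\ (2 ^ (l - 1) <= n)%N) ->
  0 <= a <= 1 -> exists2 V, special_orthogonal_group V & Phi V = a *: Phi 1%:M.
Proof.
move=> nl a01.
have clifford_case N : clifford_system R N l -> (0 < N <= n)%N ->
    exists2 V, special_orthogonal_group V & Phi V = a *: Phi 1%:M.
  move=> cl Nn; have [C C0 H] := shrink_round Phi cl Nn.
  have := @euler_star_shaped _ 'rV[R]_l
    (Phi @` (@special_orthogonal_group R n)) C C0.
  have stp x d : (Phi @` (@special_orthogonal_group R n)) x -> 0 <= d <= 1 ->
      exists2 y, (Phi @` (@special_orthogonal_group R n)) y &
      `|y - (1 - d) *: x| <= C * (d * Num.sqrt d).
    move=> [V SV <-] d01; have [W SW WV] := H V d SV d01.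
    by exists (Phi W) => //; exists W.
  move=> /(_ stp (closed_special_orthogonal_image (Phi := Phi)) (Phi 1%:M) a).
  by case=> // [|V SV <-]; [exists 1%:M => //;
    exact: special_orthogonal1 | exists V].
case: nl => [[l2 n3]|[l3 ln]]; last first.
  by apply: (clifford_case (2 ^ (l - 1))%N);
    [exact: clifford_system_pow2 | rewrite expn_gt0].
move: n3; rewrite leq_eqVlt => /orP[/eqP n3|n4].
  by subst l n; exact: special_orthogonal3_shrink.
by apply: (clifford_case 4%N) => //; rewrite l2; apply: clifford_system_sub;
  exact: clifford_system4.
Qed.

Lemma special_orthogonal_acts (R : realType) n (G : set 'M[R]_n) :
  G = @orthogonal_group R n \/ G = @special_orthogonal_group R n ->
  G 1%:M /\ forall U V, special_orthogonal_group U -> G V -> G (U *m V).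
Proof.
case=> ->; split; [by case: (special_orthogonal1 R n) | | exact:
  special_orthogonal1 | exact: special_orthogonalM].
by move=> U V [OU _] OV; exact: orthogonalM.
Qed.

Theorem theorem2p12 (R : realType) (m n l : nat)
    (m_gt0 : (0 < m)%N) (n_gt0 : (0 < n)%N) (l_gt0 : (0 < l)%N)
    (L : {linear {ffun 'I_m -> 'M[R]_n} -> 'rV[R]_l})
    (A : {ffun 'I_m -> 'M[R]_n}) (G : set 'M[R]_n)
    (hG : G = @orthogonal_group R n \/ G = @special_orthogonal_group R n)
    (hnl : (l = 2%N /\ (3 <= n)%N) \/ ((3 <= l)%N /\ (2 ^ (l - 1) <= n)%N)) :
  [/\ star_shaped (L @` orbit1 A G) 0,
      star_shaped (L @` orbit2 A G) 0
    & star_shaped (L @` orbit3 A G) 0].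
Proof.
have [G1 GM] := special_orthogonal_acts hG.
(* It is enough that every point of S is F 1 for a linear F mapping SO_n
   into S. *)
have star (S : set {ffun 'I_m -> 'M[R]_n}) : (exists x, S x) ->
    (forall x, S x -> exists2 F : 'M[R]_n -> {ffun 'I_m -> 'M[R]_n},
       linear F & F 1%:M = x /\ forall X, special_orthogonal_group X ->
         S (F X)) ->
    star_shaped (L @` S) 0.
  move=> [x0 Sx0] H.
  have shrink x a : S x -> 0 <= a <= 1 -> (L @` S) (a *: L x).
    move=> Sx a01; have [F linF [F1 SF]] := H x Sx.
    have linLF : linear (L \o F) by move=> c X Y; rewrite /= linF linearP.
    pose Phi : {linear 'M[R]_n -> 'rV[R]_l} :=
      HB.pack (L \o F) (GRing.isLinear.Build R 'M[R]_n 'rV[R]_l *:%R (L \o F)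
        linLF).
    have [X SX] := special_orthogonal_shrink Phi hnl a01; rewrite /= F1 => <-.
    by exists (F X) => //; exact: SF.
  split; first by rewrite -(scale0r (L x0)); apply: shrink;
    rewrite // lexx ler01.
  by move=> a _ a01 [x Sx <-]; rewrite scaler0 addr0; exact: shrink.
have linF (B C : 'I_m -> 'M[R]_n) :
    linear (fun X : 'M[R]_n => [ffun i => B i *m X *m C i]).
  move=> c X Y; apply/ffunP=> i; rewrite !ffunE.
  by rewrite mulmxDr mulmxDl -scalemxAr -scalemxAl.
split; apply: star.
- by exists [ffun i => A i *m 1%:M]; exists 1%:M.
- move=> _ [V GV <-]; exists (fun X => [ffun i => A i *m X *m V]);
  first exact: linF.
  split; first by apply/ffunP=> i; rewrite !ffunE mulmx1.
  move=> X SX; exists (X *m V); first exact: GM.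
  by apply/ffunP=> i; rewrite !ffunE mulmxA.
- by exists [ffun i => 1%:M *m A i]; exists 1%:M.
- move=> _ [U GU <-]; exists (fun X => [ffun i => 1%:M *m X *m (U *m A i)]);
  first exact: linF.
  split; first by apply/ffunP=> i; rewrite !ffunE !mul1mx.
  move=> X SX; exists (X *m U); first exact: GM.
  by apply/ffunP=> i; rewrite !ffunE mul1mx mulmxA.
- by exists [ffun i => 1%:M *m A i *m 1%:M]; exists 1%:M => //; exists 1%:M.
- move=> _ [U GU [V GV <-]].
  exists (fun X => [ffun i => 1%:M *m X *m (U *m A i *m V)]); first exact: linF.
  split; first by apply/ffunP=> i; rewrite !ffunE !mul1mx.
  move=> X SX; exists (X *m U); first exact: GM.
  by exists V => //; apply/ffunP=> i; rewrite !ffunE mul1mx !mulmxA.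
Qed.
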